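(* For each $d\ge1$ there is a constant $c>0$ depending only on $d$ such that the following holds for every integer $n\ge 1$. Suppose $D\subset\mathbb{R}^d$ is a compact set and $T$ is an affine transformation of $\mathbb{R}^d$ such that $TB_2^d\subset D$. Then $$C(\mathcal{P}_n,D,Tv_n^d)\le c\,|\det T|^{-1}n^{d+1}.$$
   Context: $B_2^d$ is the closed Euclidean unit ball of $\mathbb{R}^d$, and $v_n^d=(1+\frac{1}{3n^{2}},0,\dots,0)\in\mathbb{R}^d$. Affine transformations $Tx=x_0+Ax$ are always assumed non-degenerate, and $\det T:=\det A\neq 0$. $\mathcal{P}_n=\mathcal{P}_{n,d}$ is the space of real algebraic polynomials in $d$ variables of total degree $\le n$. For a compact set $D\subset\mathbb{R}^d$ of positive Lebesgue measure and $x\in\mathbb{R}^d$ (not necessarily in $D$), $C(\mathcal{P}_n,D,x)=\sum_{k=1}^N\phi_k(x)^2$, where $\{\phi_k\}_{k=1}^N$ is any basis of $\mathcal{P}_n$ that is orthonormal in $L_2(D)$ with respect to Lebesgue measure (the value does not depend on the choice of the orthonormal basis). *)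

(* Defs.v *)
From HB Require Import structures.
From mathcomp Require Import all_boot all_order all_algebra.
(* The notations of mpoly clash with those of MathComp-Analysis. *)
From mathcomp Require Import -(notations) mpoly.
From mathcomp Require Import all_classical all_reals all_analysis.
From mathcomp Require Import measurable_realfun.
From mathcomp Require Import lra.

Set Implicit Arguments.
Unset Strict Implicit.
Unset Printing Implicit Defensive.

Import Order.TTheory GRing.Theory Num.Theory.
Import numFieldNormedType.Exports.

Local Open Scope classical_set_scope.
Local Open Scope ring_scope.

(* As for tuples in MathComp-Analysis, the sigma-algebra on column vectors is
   the one generated by the coordinate maps. *)
Section measurable_cV.
Context {R : realType}.
Variable d : nat.

Let coors : 'I_d -> 'cV[R]_d -> measurableTypeR R := fun i x => x i ord0.

Let cV_set0 : g_sigma_preimage coors set0.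
Proof. exact: sigma_algebra0. Qed.

Let cV_setC A : g_sigma_preimage coors A -> g_sigma_preimage coors (~` A).
Proof. exact: sigma_algebraC. Qed.

Let cV_bigcup (F : _^nat) : (forall i, g_sigma_preimage coors (F i)) ->
  g_sigma_preimage coors (\bigcup_i (F i)).
Proof. exact: sigma_algebra_bigcup. Qed.

HB.instance Definition _ :=
  @isMeasurable.Build (measure_tuple_display default_measure_display)
    'cV[R]_d (g_sigma_preimage coors) cV_set0 cV_setC cV_bigcup.

End measurable_cV.

Section measurable_cV_theory.
Context {R : realType}.

Lemma measurable_coor d (i : 'I_d) :
  measurable_fun setT (fun x : 'cV[R]_d => x i ord0 : measurableTypeR R).
Proof.
move=> _ Y mY; rewrite setTI; apply: sub_sigma_algebra => /=.
rewrite -bigcup_seq/=; exists i => /=; first by rewrite mem_index_enum.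
by exists Y => //; rewrite setTI.
Qed.

Lemma measurable_fun_cVP d0 (T : measurableType d0) d (f : T -> 'cV[R]_d) :
  (forall i, measurable_fun setT (fun t => f t i ord0 : measurableTypeR R)) ->
  measurable_fun setT f.
Proof.
move=> mf _ A mA; rewrite setTI; move: A mA.
pose S : set (set 'cV[R]_d) := [set A | measurable (f @^-1` A)].
have sS : sigma_algebra setT S.
  split => [|A SA|F SF]; rewrite /S/=.
  - by rewrite preimage_set0.
  - by rewrite setTD preimage_setC; exact: measurableC.
  - by rewrite preimage_bigcup; apply: bigcup_measurable => k _; exact: SF.
have sub : forall A, (@measurable _ 'cV[R]_d) A -> S A.
  apply: smallest_sub => //.
  rewrite -bigcup_seq/= => A [i _ [B mB <-]]; rewrite /S/= setTI.
  have := mf i measurableT B mB.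
  by rewrite setTI.
exact: sub.
Qed.
End measurable_cV_theory.

(* Lebesgue measure on R^d, as the d-fold product of the Lebesgue measure on R;
   [lebesgue_cV_box] gives its values on boxes. *)
Section lebesgue_cV.
Context {R : realType}.

Definition cons_cV d (p : measurableTypeR R * 'cV[R]_d) : 'cV[R]_d.+1 :=
  \col_i (if unlift ord0 i is Some j then p.2 j ord0 else p.1).

Definition uncons_cV d (x : 'cV[R]_d.+1) : measurableTypeR R * 'cV[R]_d :=
  (x ord0 ord0, \col_i x (lift ord0 i) ord0).

Lemma cons_cV0 d p : @cons_cV d p ord0 ord0 = p.1.
Proof. by rewrite mxE unlift_none. Qed.

Lemma cons_cVS d p (i : 'I_d) : @cons_cV d p (lift ord0 i) ord0 = p.2 i ord0.
Proof. by rewrite mxE liftK. Qed.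

Lemma cons_cVK d : cancel (@cons_cV d) (@uncons_cV d).
Proof.
move=> [a v]; rewrite /uncons_cV cons_cV0/=; congr pair.
by apply/colP => i; rewrite mxE cons_cVS.
Qed.

Lemma measurable_cons_cV d : measurable_fun setT (@cons_cV d).
Proof.
apply: measurable_fun_cVP => i.
have [j ->|->] := unliftP ord0 i.
  under eq_fun do rewrite cons_cVS.
  apply: (measurableT_comp (measurable_coor j)); exact: measurable_snd.
by under eq_fun do rewrite cons_cV0; exact: measurable_fst.
Qed.

Lemma measurable_uncons_cV d : measurable_fun setT (@uncons_cV d).
Proof.
apply: measurable_fun_pair; first exact: measurable_coor.
apply: measurable_fun_cVP => i.
by under eq_fun do rewrite mxE; exact: measurable_coor.
Qed.

Section step.
Variables (d : nat) (mu : {sigma_finite_measure set 'cV[R]_d -> \bar R}).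

Definition lebesgue_step : set 'cV[R]_d.+1 -> \bar R :=
  pushforward (@lebesgue_measure R \x mu)%E (@cons_cV d).

Let mc := @measurable_cons_cV d.

Let step0 : lebesgue_step set0 = 0%E.
Proof. exact: measure0. Qed.

Let step_ge0 A : (0 <= lebesgue_step A)%E.
Proof. exact: measure_ge0. Qed.

Let step_sigma_additive : semi_sigma_additive lebesgue_step.
Proof. exact: measure_semi_sigma_additive. Qed.

HB.instance Definition _ := isMeasure.Build _ _ _ lebesgue_step
  step0 step_ge0 step_sigma_additive.

Let step_sigma_finite : sigma_finite setT lebesgue_step.
Proof.
have /sigma_finiteP[F [TF ndF Foo]] := sigma_finiteT (@lebesgue_measure R).
have /sigma_finiteP[G [TG ndG Goo]] := sigma_finiteT mu.
exists (fun k => @uncons_cV d @^-1` (F k `*` G k)).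
  rewrite -preimage_bigcup; apply/esym; rewrite -subTset => x _.
  have [i _ Fi] : (\bigcup_i F i) (uncons_cV x).1 by rewrite -TF.
  have [j _ Gj] : (\bigcup_i G i) (uncons_cV x).2 by rewrite -TG.
  exists (maxn i j) => //; split.
  - by move: Fi; exact/subsetPset/ndF/leq_maxl.
  - by move: Gj; exact/subsetPset/ndG/leq_maxr.
move=> k; have [mF Fk] := Foo k; have [mG Gk] := Goo k.
have mFG : measurable (F k `*` G k) by exact: measurableX.
split; first by rewrite -[X in measurable X]setTI; exact: measurable_uncons_cV.
rewrite /lebesgue_step /pushforward -comp_preimage.
rewrite (_ : _ \o _ = id) ?preimage_id; last first.
  by apply/funext => p; exact: cons_cVK.
by rewrite product_measure1E// lte_mul_pinfty// ge0_fin_numE.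
Qed.

HB.instance Definition _ := Measure_isSigmaFinite.Build _ _ _ lebesgue_step
  step_sigma_finite.
End step.

Fixpoint lebesgue_cV d : {sigma_finite_measure set 'cV[R]_d -> \bar R} :=
  if d is d'.+1 return {sigma_finite_measure set 'cV[R]_d -> \bar R}
  then lebesgue_step (lebesgue_cV d') else \d_(0 : 'cV[R]_0).

Lemma lebesgue_cV_box d (A : 'I_d -> set (measurableTypeR R)) :
  (forall i, measurable (A i)) ->
  lebesgue_cV d [set x | forall i, A i (x i ord0)] =
  (\prod_(i < d) lebesgue_measure (A i))%E.
Proof.
elim: d A => [|d IH] A mA.
  by rewrite big_ord0/= diracE mem_set//= => -[].
rewrite big_ord_recl -IH; last by move=> i; exact: mA.
have mB : measurable [set x : 'cV[R]_d | forall i, A (lift ord0 i) (x i ord0)].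
  rewrite (_ : [set x | _] = \bigcap_(i in [set: 'I_d])
      ((fun x : 'cV[R]_d => x i ord0 : measurableTypeR R) @^-1` A (lift ord0 i))).
    apply: fin_bigcap_measurable => //= i _.
    by rewrite -[X in measurable X]setTI; exact: measurable_coor.
  by apply/seteqP; split => x /= Ax i; [move=> _; exact: Ax|exact: Ax i I].
rewrite -product_measure1E//= /lebesgue_step /pushforward; congr (_ \x _)%E.
apply/seteqP; split => -[a v] /=.
  move=> Av; split => [|i]; first by have := Av ord0; rewrite cons_cV0.
  by have := Av (lift ord0 i); rewrite cons_cVS.
move=> [Aa Av] i; have [j ->|->] := unliftP ord0 i.
  by rewrite cons_cVS; exact: Av.
by rewrite cons_cV0.
Qed.

End lebesgue_cV.

Section christoffel.
Context {R : realType} {d : nat}.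
Implicit Types (D : set 'cV[R]_d) (p : mpoly d R) (x : 'cV[R]_d).

Definition mpoly_eval p x : R := meval (fun i => x i ord0) p.

(* The space P_n of polynomials of total degree at most n: the library's [msize]
   is one plus the total degree, and 0 for the zero polynomial. *)
Definition degree_le n p : bool := (mpoly.msize p <= n.+1)%N.

Definition polynomial_basis n N (phi : 'I_N -> mpoly d R) : Prop :=
  [/\ forall k, degree_le n (phi k),
      forall a : 'I_N -> R,
        \sum_(k < N) a k *: phi k = 0 -> forall k, a k = 0 &
      forall p, degree_le n p ->
        exists a : 'I_N -> R, p = \sum_(k < N) a k *: phi k].

Definition orthonormal D N (phi : 'I_N -> mpoly d R) : Prop :=
  forall i j, (\int[lebesgue_cV d]_(x in D)
    (mpoly_eval (phi i) x * mpoly_eval (phi j) x)%:E)%E = (i == j)%:R%:E.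

(* C(P_n, D, x), for D compact of positive Lebesgue measure: the common value
   ([christoffelE] below) of the sum over all orthonormal bases. *)
Definition christoffel n D x : R :=
  get [set s | exists N (phi : 'I_N -> mpoly d R),
    [/\ polynomial_basis n phi, orthonormal D phi &
        s = \sum_(k < N) mpoly_eval (phi k) x ^+ 2]].

Lemma measurable_mpoly_eval p : measurable_fun setT (mpoly_eval p).
Proof.
rewrite /mpoly_eval; under eq_fun do rewrite mevalE.
apply: measurable_sum => m; apply: measurable_funM => //.
apply: measurable_prod => i _; apply: measurable_funX.
exact: (measurable_coor i).
Qed.

Lemma open_measurable_cV (U : set 'cV[R]_d) : open U -> measurable U.
Proof.
move=> oU.
pose B (q : 'cV[rat]_d) (k : nat) : set 'cV[R]_d :=
  \bigcap_(i in [set: 'I_d])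
    ((fun x : 'cV[R]_d => x i ord0 : measurableTypeR R) @^-1`
      (ball (ratr (q i ord0) : R) k.+1%:R^-1)).
have mB q k : measurable (B q k).
  apply: fin_bigcap_measurable => //= i _.
  rewrite -[X in measurable X]setTI; apply: (measurable_coor i) => //.
  exact: measurable_ball.
have -> : U = \bigcup_(k in [set: nat]) \bigcup_(q in [set q | B q k `<=` U]) B q k.
  apply/seteqP; split=> [x Ux|x [k _ [q /= BU]]]; last exact: BU.
  have /nbhs_ballP[e /= e0 eU] : nbhs x U by exact: open_nbhs_nbhs.
  have [k ke] : exists k, k.+1%:R^-1 < e / 2 :> R.
    have [N _ /(_ N (leqnn N)) H] : \forall k \near \oo, k.+1%:R^-1 < e / 2 :> R.
      exact: (near_infty_natSinv_lt (PosNum (divr_gt0 e0 (ltr0n _ 2)))).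
    by exists N.
  have k0 : 0 < k.+1%:R^-1 :> R by rewrite invr_gt0.
  have /choice[q Hq] : forall i : 'I_d, exists q : rat, `|ratr q - x i ord0| < k.+1%:R^-1.
    move=> i; have : x i ord0 - k.+1%:R^-1 < x i ord0 + k.+1%:R^-1.
      by rewrite ltrBlDr -addrA ltrDl addr_gt0.
    move=> /rat_in_itvoo[q]; rewrite in_itv/= => /andP[q1 q2]; exists q.
    by rewrite ltr_distl q1 q2.
  exists k => //; exists (\col_i q i) => /= [y By|i _ /=].
    apply: eU; split => // i j; rewrite (ord1 j).
    have := By i I; rewrite /= mxE /ball/= => yq.
    have xq := Hq i.
    rewrite -(subrK (ratr (q i)) (x i ord0)) -addrA.
    apply: le_lt_trans (ler_normD _ _) _.
    by rewrite [e]splitr ltrD// ?(lt_trans _ ke)// distrC.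
  by rewrite mxE /ball/=; exact: Hq.
apply: bigcup_measurable => k _; rewrite bigcup_mkcond.
apply: countable_bigcupT_measurable => // q.
by case: ifPn.
Qed.

Lemma compact_measurable_cV D : compact D -> measurable D.
Proof.
move=> cD0; have cD : closed D.
  by apply: compact_closed cD0; exact: (@norm_hausdorff R 'cV[R]_d).
rewrite -(setCK D); apply: measurableC; apply: open_measurable_cV.
exact: closed_openC.
Qed.

Lemma integrable_orthonormal D N (phi : 'I_N -> mpoly d R) i j :
  compact D -> orthonormal D phi ->
  (lebesgue_cV d).-integrable D
    (fun x => (mpoly_eval (phi i) x * mpoly_eval (phi j) x)%:E).
Proof.
move=> /compact_measurable_cV mD ophi.
have mM k l : measurable_fun D
    (fun x => (mpoly_eval (phi k) x * mpoly_eval (phi l) x)%:E).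
  apply/measurable_EFinP/measurable_funTS.
  by apply: measurable_funM; exact: measurable_mpoly_eval.
have int2 k : (lebesgue_cV d).-integrable D
    (fun x => (mpoly_eval (phi k) x * mpoly_eval (phi k) x)%:E).
  apply/integrableP; split => //.
  rewrite (eq_integral (fun x => (mpoly_eval (phi k) x * mpoly_eval (phi k) x)%:E)).
    by rewrite ophi ltry.
  by move=> x _; rewrite gee0_abs// lee_fin -expr2 sqr_ge0.
have amgm (a b : R) : 0 <= a -> 0 <= b -> a * b <= a ^+ 2 + b ^+ 2.
  by move=> a0 b0; nra.
apply: le_integrable (integrableD mD (int2 i) (int2 j)) => // x _.
rewrite /= lee_fin -!expr2 [leRHS]ger0_norm ?addr_ge0 ?sqr_ge0// normrM.
rewrite -(real_normK (num_real (mpoly_eval (phi i) x))).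
rewrite -(real_normK (num_real (mpoly_eval (phi j) x))).
exact: amgm.
Qed.

Lemma christoffelE n D x N (phi : 'I_N -> mpoly d R) :
  compact D -> polynomial_basis n phi -> orthonormal D phi ->
  christoffel n D x = \sum_(k < N) mpoly_eval (phi k) x ^+ 2.
Proof.
move=> cD bphi ophi; have mD := compact_measurable_cV cD.
rewrite /christoffel.
set S := [set s | _].
have : S (get S).
  by apply: getPex; exists (\sum_(k < N) mpoly_eval (phi k) x ^+ 2); exists N, phi.
move=> [M [psi [bpsi opsi ->]]].
have [dphi fphi sphi] := bphi; have [dpsi fpsi spsi] := bpsi.
have /choice[A HA] k := sphi _ (dpsi k).
have /choice[B HB] k := spsi _ (dphi k).
have evA k y : mpoly_eval (psi k) y = \sum_i A k i * mpoly_eval (phi i) y.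
  rewrite /mpoly_eval HA raddf_sum/=; apply: eq_bigr => i _.
  by rewrite mevalZ.
pose mA : 'M[R]_(M, N) := \matrix_(k, i) A k i.
pose mB : 'M[R]_(N, M) := \matrix_(k, i) B k i.
have BA : mB *m mA = 1%:M.
  apply/matrixP => k l; rewrite !mxE.
  under eq_bigr do rewrite !mxE.
  apply/eqP; rewrite -subr_eq0; apply/eqP.
  move: l; apply: (fphi (fun l => \sum_j B k j * A j l - (k == l)%:R)).
  under eq_bigr do rewrite scalerBl scaler_suml.
  rewrite sumrB exchange_big/=.
  have -> : \sum_i (k == i)%:R *: phi i = phi k.
    rewrite (bigD1 k)//= eqxx scale1r big1 ?addr0// => i ik.
    by rewrite eq_sym (negbTE ik) scale0r.
  apply/eqP; rewrite subr_eq0 eq_sym; apply/eqP.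
  rewrite {1}HB; apply: eq_bigr => j _.
  by rewrite {1}HA scaler_sumr; apply: eq_bigr => i _; rewrite scalerA.
have AAT : mA *m mA^T = 1%:M.
  apply/matrixP => k l; rewrite !mxE.
  under eq_bigr do rewrite !mxE.
  apply: EFin_inj; rewrite -opsi.
  under [RHS]eq_integral => y _.
    rewrite !evA mulr_suml -sumEFin.
    under eq_bigr => i _.
      rewrite mulr_sumr -sumEFin.
      under eq_bigr => j _ do rewrite mulrACA EFinM.
      over.
    over.
  rewrite integral_sum//=; last first.
    move=> i; apply: integrable_sum => // j _; apply: integrableZl => //.
    exact: integrable_orthonormal.
  rewrite -sumEFin; apply: eq_bigr => i _.
  rewrite integral_sum//=; last first.
    move=> j; apply: integrableZl => //; exact: integrable_orthonormal.
  rewrite (bigD1 i)//= integralZl//; last exact: integrable_orthonormal.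
  rewrite ophi eqxx mule1 big1 ?adde0// => j ji.
  rewrite integralZl//; last exact: integrable_orthonormal.
  by rewrite ophi eq_sym (negbTE ji) mule0.
have ATA : mA^T *m mA = 1%:M.
  by rewrite -[mA^T]mul1mx -BA -(mulmxA mB) AAT mulmx1.
pose u := \col_k mpoly_eval (psi k) x; pose v := \col_k mpoly_eval (phi k) x.
have uE : u = mA *m v.
  by apply/colP => k; rewrite !mxE evA; apply: eq_bigr => i _; rewrite !mxE.
have normE m (w : 'cV[R]_m) : \sum_k w k ord0 ^+ 2 = (w^T *m w) ord0 ord0.
  by rewrite mxE; apply: eq_bigr => i _; rewrite mxE expr2.
transitivity (\sum_k u k ord0 ^+ 2); first by apply: eq_bigr => k _; rewrite mxE.
rewrite normE uE trmx_mul mulmxA -(mulmxA v^T) ATA mulmx1 -normE.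
by apply: eq_bigr => k _; rewrite mxE.
Qed.

End christoffel.

Section affine.
Context {R : realType} {d : nat}.

Definition euclidean_norm (x : 'cV[R]_d) : R :=
  Num.sqrt (\sum_(i < d) x i ord0 ^+ 2).

Definition euclidean_ball : set 'cV[R]_d := [set x | euclidean_norm x <= 1].

Definition affine_map (x0 : 'cV[R]_d) (A : 'M[R]_d) (x : 'cV[R]_d) : 'cV[R]_d :=
  x0 + A *m x.

End affine.

(* v_n^d = (1 + 1 / (3 n^2), 0, ..., 0) *)
Definition outer_point {R : realType} (d n : nat) : 'cV[R]_d :=
  \col_(i < d) (if val i == 0%N then 1 + (3 * n%:R ^+ 2)^-1 else 0).

(* Main.v *)
Require Import Defs.
From mathcomp Require Import all_boot all_order all_algebra qpoly.
From mathcomp Require Import -(notations) mpoly.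
From mathcomp Require Import all_classical all_reals all_analysis.
From mathcomp Require Import measurable_realfun ring lra.

(** Write [v] for the outer point, [T] for the affine map [x |-> x0 + A x], and
    [p] for a polynomial of degree at most [n].  The sum of squares of an
    orthonormal basis at [x] is the largest value of [p(x)^2 / int_D p^2], so
    it is enough to bound [p(T v)^2] by a multiple of
    [|det A|^-1 n^(d+1) int_D p^2]; this reduction is [christoffel_le].

    The bound comes from reproducing [p(T v)] along parabolas that start at
    [v] and enter the ball.  For [y = (y_0, y')] the parabola
    [t |-> v + (- t^2 y_0, t y')] starts at [v], and the even part of
    [t |-> p(T(v + (- t^2 y_0, t y')))] is a univariate polynomial of degree at
    most [n] in [s = t^2].  Its value at [s = 0] is therefore a fixed
    combination, with coefficients [l_k], of its values at [n + 1] nodes [s_k].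
    If the nodes and [0] are in the relative position of the extrema of the
    Chebyshev polynomial [T_n] and a point outside its interval at relative
    distance of order [n^-2], then the sum of the [|l_k|] is a value of [T_n]
    at that point, which is bounded independently of [n]
    ([extrapolation_nodes]).

    For fixed [s_k] the point [v + (- s_k y_0, +- sqrt s_k y')] depends on [y]
    through a linear map [P_k] with [|det P_k| = s_k^((d+1)/2)], and this is at
    least a constant times [n^-(d+1)] because [s_k] is at least a constant times
    [n^-2].  When [y] runs over a fixed thin box [Q] all these points stay in
    the unit ball ([parabolic_sub_ball]).  Squaring the extrapolation formula
    by the Cauchy-Schwarz inequality, integrating it over [Q], and changing
    variables in each term turns every term into at most
    [|det (A P_k)|^-1 int_D p^2] ([averaged_extrapolation]), which is the claim.

    The change of variables [x |-> c + M x] for the product Lebesgue measure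
    ([integral_affine_map]) is obtained by induction on the dimension: up to a
    shear that makes the first pivot nonzero, [M] is a product of two block
    triangular matrices, and for those the statement follows from Tonelli's
    theorem, the one-dimensional case, and the induction hypothesis. *)

Set Implicit Arguments.
Unset Strict Implicit.
Unset Printing Implicit Defensive.

Import Order.TTheory GRing.Theory Num.Theory.
Import numFieldNormedType.Exports.

Local Open Scope classical_set_scope.
Local Open Scope ring_scope.

(** * Chebyshev polynomials and extrapolation nodes *)

Section chebyshev.
Context {R : realType}.
Implicit Types (n : nat) (x z t : R).

Fixpoint chebyshev n : {poly R} :=
  if n is m.+1 then
    if m is k.+1 then (2 *: 'X) * chebyshev m - chebyshev k else 'X
  else 1.

Lemma chebyshevSS n :
  chebyshev n.+2 = (2 *: 'X) * chebyshev n.+1 - chebyshev n.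
Proof. by []. Qed.

Lemma two_step_ind (P : nat -> Prop) :
  P 0%N -> P 1%N -> (forall n, P n -> P n.+1 -> P n.+2) -> forall n, P n.
Proof.
move=> P0 P1 PS n; suff: P n /\ P n.+1 by case.
by elim: n => // n [Pn PSn]; split => //; exact: PS.
Qed.

Lemma size_chebyshev n : (size (chebyshev n) <= n.+1)%N.
Proof.
elim/two_step_ind: n => [||n IH1 IH2]; rewrite ?size_poly1 ?size_polyX//.
rewrite chebyshevSS (leq_trans (size_polyD _ _))// geq_max size_polyN.
apply/andP; split; last exact: leq_trans IH1 (leqW (leqnSn _)).
rewrite -scalerAl; apply: leq_trans (size_scale_leq _ _) _.
by apply: leq_trans (size_polyMleq _ _) _; rewrite size_polyX.
Qed.

Lemma chebyshev_cos n t : (chebyshev n).[cos t] = cos (t *+ n).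
Proof.
elim/two_step_ind: n => [||n IH1 IH2]; first by rewrite hornerE mulr0n cos0.
  by rewrite hornerX mulr1n.
rewrite chebyshevSS !hornerE IH1 IH2.
have -> : t *+ n.+2 = t *+ n.+1 + t by rewrite -mulrSr.
have -> : t *+ n = t *+ n.+1 - t by rewrite mulrSr addrK.
rewrite !cosD cosN sinN; ring.
Qed.

(** Evaluating at [(z + z^-1) / 2] gives closed values outside [[-1, 1]], where
    the trigonometric formula is not available. *)
Lemma chebyshev_joukowski n z : z != 0 ->
  (chebyshev n).[(z + z^-1) / 2] = (z ^+ n + z ^- n) / 2.
Proof.
move=> z0; elim/two_step_ind: n => [||n IH1 IH2].
- by rewrite hornerE !expr0 invr1 divff.
- by rewrite hornerX !expr1.
- rewrite chebyshevSS !hornerE IH1 IH2.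
  rewrite /= !exprS; field.
  by rewrite z0 expf_neq0.
Qed.

(** Exactly [k] nodes lie to the right of the [k]-th one. *)
Lemma prod_node_differences (n : nat) (x : nat -> R) (k : 'I_n) :
  (forall i j, (i < j)%N -> x j < x i) ->
  \prod_(j < n | j != k) (x k - x j) =
  (-1) ^+ k * \prod_(j < n | j != k) `|x k - x j|.
Proof.
move=> x_decr.
have -> : (-1) ^+ k = \prod_(j < n | j != k) (if (j < k)%N then -1 else 1) :> R.
  transitivity (\prod_(j < n | (j < k)%N) (-1 : R)).
    rewrite -(big_ord_widen n (fun=> -1 : R) (ltnW (ltn_ord k))).
    by rewrite prodr_const card_ord.
  by rewrite big_mkcond (bigD1 k)//= ltnn mul1r.
rewrite -big_split/=; apply: eq_bigr => j jk.
have [jltk|] := ltnP j k.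
  by rewrite ltr0_norm ?subr_lt0 ?x_decr// mulN1r opprK.
rewrite leq_eqVlt eq_sym val_eqE (negbTE jk)/= => kj.
by rewrite mul1r gtr0_norm// subr_gt0 x_decr.
Qed.

(** The Lagrange coefficients at a point to the right of all nodes alternate in
    sign.  A polynomial taking the values [(-1) ^+ k] at the nodes alternates in
    the same way, so its extrapolation adds up the absolute values of the
    coefficients. *)
Lemma lagrange_functional (n : nat) (x : nat -> R) (T : {poly R}) (y : R) :
  (0 < n)%N ->
  (forall i j, (i < j)%N -> x j < x i) ->
  (size T <= n)%N -> (forall k : 'I_n, T.[x k] = (-1) ^+ k) -> x 0%N < y ->
  exists2 l : 'I_n -> R,
    forall H : {poly R}, (size H <= n)%N -> H.[y] = \sum_(k < n) l k * H.[x k] &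
    \sum_(k < n) `|l k| = T.[y].
Proof.
move=> n0 x_decr sT Tx xy.
have x_inj : injective x.
  by move=> i j xij; case: (ltngtP i j) => // /x_decr; rewrite xij ltxx.
have ltxy k : x k < y.
  by case: k => // k; exact: lt_trans (x_decr _ _ (ltn0Sn k)) xy.
pose l (k : 'I_n) :=
  (\prod_(j < n | j != k) (x k - x j))^-1 * \prod_(j < n | j != k) (y - x j).
have lE (H : {poly R}) : (size H <= n)%N -> H.[y] = \sum_(k < n) l k * H.[x k].
  move=> sH; rewrite [in LHS](lagrange_gen n0 x_inj sH) horner_sum.
  apply: eq_bigr => k _; rewrite hornerM hornerC lagrangeE//= hornerM hornerC.
  rewrite mulrC /l !horner_prod; congr (_^-1 * _ * _);
    by apply: eq_bigr => j _; rewrite hornerXsubC.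
exists l => //.
rewrite (lE _ sT); apply: eq_bigr => k _; rewrite Tx.
pose m := (\prod_(j < n | j != k) `|x k - x j|)^-1 * \prod_(j < n | j != k) (y - x j).
have -> : l k = (-1) ^+ k * m by rewrite /l prod_node_differences// invr_signM -mulrA.
rewrite [RHS]mulrC signrMK normrMsign ger0_norm// mulr_ge0 ?invr_ge0 ?prodr_ge0//.
by move=> j _; rewrite subr_ge0 ltW.
Qed.

(** The nodes form a strictly decreasing sequence on all of [nat], because
    interpolation is stated for injective sequences; only the first [n + 1]
    terms are extrema of the Chebyshev polynomial. *)
Lemma chebyshev_nodes (n : nat) : (0 < n)%N ->
  exists x : nat -> R, [/\ forall i j, (i < j)%N -> x j < x i,
    forall k : 'I_n.+1, (chebyshev n).[x k] = (-1) ^+ k &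
    forall k : 'I_n.+1, -1 <= x k <= 1].
Proof.
move=> n0; have n0' : 0 < n%:R :> R by rewrite ltr0n.
pose t k : R := pi / n%:R *+ k.
(* An index k > n is at least 2, hence - k stays below the values of cos. *)
exists (fun k => if (k <= n)%N then cos (t k) else - k%:R).
have tn k : (k <= n)%N -> t k \in `[0, pi].
  move=> kn; rewrite in_itv/= /t -mulr_natr mulr_ge0 ?divr_ge0 ?pi_ge0//=.
  by rewrite mulrAC ler_pdivrMr// ler_wpM2l ?pi_ge0// ler_nat.
split => [i j ij|k|k].
- case: leqP => jn; last first.
    case: leqP => _; last by rewrite ltrN2 ltr_nat.
    by rewrite (lt_le_trans _ (cos_geN1 _))// ltrN2 ltr1n (leq_ltn_trans _ jn).
  rewrite (leq_trans (ltnW ij) jn) ltr_cos ?tn ?(leq_trans (ltnW ij) jn)//.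
  by rewrite /t -[X in X < _]mulr_natr -[X in _ < X]mulr_natr ltr_pM2l ?ltr_nat// divr_gt0// pi_gt0.
- have kn : (k <= n)%N by rewrite -ltnS.
  rewrite kn chebyshev_cos /t -mulrnA mulnC mulrnA -[X in X *+ k]mulr_natr.
  rewrite divfK ?gt_eqF//; elim: (val k) => [|m IH]; first by rewrite mulr0n cos0.
  by rewrite mulrSr cosDpi IH exprS mulN1r.
- have kn : (k <= n)%N by rewrite -ltnS.
  by rewrite kn cos_geN1 cos_le1.
Qed.

(** The point [y = (z + z^-1) / 2] with [z = 1 + 8 / n] exceeds [1] by a quantity
    of order [n^-2], so that [T_n(y)] is at most [z^n <= e^8].  The reflected
    and rescaled nodes [c * (y - x_k)] lie in [(0, 3/4]], and extrapolation to
    [0] has the same coefficients as extrapolation to [y]. *)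
Lemma extrapolation_nodes : exists2 L : R, 0 < L &
  forall n, (0 < n)%N -> exists s l : 'I_n.+1 -> R,
    [/\ forall k, 4 / (9 * n%:R ^+ 2) <= s k <= 3 / 4,
        forall H : {poly R}, (size H <= n.+1)%N ->
          H.[0] = \sum_(k < n.+1) l k * H.[s k] &
        \sum_(k < n.+1) `|l k| <= L].
Proof.
exists (expR 8); first exact: expR_gt0.
move=> n n0; have n1 : 1 <= n%:R :> R by rewrite ler1n.
have [x [x_decr Tx x1]] := chebyshev_nodes n0.
pose z : R := 1 + 8 / n%:R; pose y := (z + z^-1) / 2.
have z1 : 1 < z by rewrite ltrDl divr_gt0// (lt_le_trans _ n1).
have y1 : 1 < y.
  rewrite -subr_gt0 (_ : _ - 1 = (z - 1) ^+ 2 / (2 * z)); last first.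
    by rewrite /y; field; rewrite gt_eqF// (lt_trans _ z1).
  by rewrite divr_gt0 ?mulr_gt0 ?exprn_gt0 ?subr_gt0// (lt_trans _ z1).
have x0y : x 0%N < y by have /andP[_] := x1 ord0; move=> /le_lt_trans; exact.
have [l lE lT] := lagrange_functional (ltn0Sn n) x_decr (size_chebyshev n) Tx x0y.
pose c := 3 / 4 / (y + 1).
have yp : 0 < y + 1 by lra.
have c0 : 0 < c by rewrite /c divr_gt0//; lra.
exists (fun k => c * (y - x k)), l; split => [k|H sH|].
- have /andP[xk1 xk2] := x1 k; apply/andP; split; last first.
    by rewrite /c mulrAC ler_pdivrMr// ler_wpM2l//; lra.
  apply: (@le_trans _ _ (c * (y - 1))); last by rewrite (ler_wpM2l (ltW c0))//; lra.
  (* (y - 1) / (y + 1) = ((z - 1) / (z + 1))^2, and n + 4 <= 5 n; the constant 8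
     in z is large enough for 3/4 * (4/5)^2 >= 4/9. *)
  rewrite (_ : c * (y - 1) = 3 / 4 * (4 / (n%:R + 4)) ^+ 2); last first.
    rewrite /c /y /z; field.
    by repeat (apply/andP; split); rewrite gt_eqF//; nra.
  have le45 : 4 / 5 * n%:R^-1 <= 4 / (n%:R + 4) :> R.
    have i1 : n%:R^-1 <= 1 :> R by rewrite invf_le1//; lra.
    have in1 : n%:R^-1 * n%:R = 1 :> R by rewrite mulVf// gt_eqF//; lra.
    by rewrite ler_pdivlMr; lra.
  apply: (@le_trans _ _ (3 / 4 * (4 / 5 * n%:R^-1) ^+ 2)); last first.
    have i0 : 0 <= n%:R^-1 :> R by rewrite invr_ge0.
    by rewrite ler_wpM2l ?lerXn2r ?nnegrE//; lra.
  have -> : 4 / (9 * n%:R ^+ 2) = 4 / 9 * n%:R^-1 ^+ 2 :> R.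
    by field; rewrite gt_eqF//; lra.
  by have := sqr_ge0 (n%:R^-1 : R); lra.
- (* The affine substitution sends y to 0 and x_k to the k-th new node. *)
  have := lE (H \Po (c *: (y%:P - 'X))).
  have sz : (size (c *: (y%:P - 'X)) <= 2)%N.
    rewrite (leq_trans (size_scale_leq _ _))// (leq_trans (size_polyD _ _))//.
    by rewrite geq_max size_polyN size_polyX size_polyC andbT; case: eqP.
  rewrite horner_comp !hornerE/= subrr mulr0 => -> //.
    by apply: eq_bigr => k _; rewrite horner_comp !hornerE.
  rewrite (leq_trans (size_comp_poly_leq _ _))//.
  rewrite ltnS (leq_trans (leq_mul (leqnn _) (_ : _ <= 1)%N))//.
    by rewrite -ltnS; case: (size _) sz => // -[].
  by rewrite muln1; case: (size H) sH.
- rewrite lT chebyshev_joukowski ?gt_eqF// ?(lt_trans _ z1)//.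
  have zn1 : 1 <= z ^+ n by rewrite exprn_ege1// ltW.
  have : z ^- n <= 1 by rewrite invf_le1// (lt_le_trans _ zn1).
  have : z ^+ n <= expR 8.
    have -> : expR 8 = expR (8 / n%:R) ^+ n :> R.
      by rewrite -expRM_natl mulrC divfK// gt_eqF// (lt_le_trans _ n1).
    by rewrite lerXn2r ?nnegrE ?expR_ge0 ?expR_ge1Dx// ltW// (lt_trans _ z1).
  lra.
Qed.

End chebyshev.

(** * Affine change of variables for Lebesgue measure *)

Section affine_lebesgue_line.
Context {R : realType}.
Local Notation mu := (@lebesgue_measure R).

Lemma measurable_affine_line (a b : R) :
  measurable_fun setT (fun t : measurableTypeR R => b + a * t : measurableTypeR R).
Proof. by apply: measurable_funD => //; exact: measurable_funM. Qed.

(** Lebesgue measure is determined by its values on half-open intervals. *)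
Lemma lebesgue_measure_affine (a b : R) (X : set (measurableTypeR R)) :
  a != 0 -> measurable X ->
  pushforward mu (fun t => b + a * t : measurableTypeR R) X =
    (`|a|^-1%:E * mu X)%E.
Proof.
move=> a0 mX; have na0 : 0 < `|a| by rewrite normr_gt0.
pose f : measurableTypeR R -> measurableTypeR R := fun t => b + a * t.
pose m := mscale (NngNum (normr_ge0 a))
  (pushforward mu f : {measure set (measurableTypeR R) -> \bar R}).
suff h : (mu X = m (measurable_affine_line a b) X)%E.
  rewrite h /m/= /mscale/= muleA -EFinM mulVf ?mul1e//.
  by rewrite gt_eqF.
apply: lebesgue_measure_unique => //.
  move=> _ [[u v]] _ <-.
  rewrite /m/= /mscale/= /pushforward.
  rewrite lebesgue_measure_itv/= lte_fin.
  have [a_gt0|a_le0] := ltP 0 a.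
    rewrite (_ : f @^-1` _ = `](u - b) / a, (v - b) / a]%classic); last first.
      apply/seteqP; split => t /=; rewrite /f !in_itv/= ltr_pdivrMr// ler_pdivlMr//;
        by rewrite mulrC ltrBlDl lerBrDl.
    rewrite lebesgue_measure_itv/= lte_fin ltr_pM2r ?invr_gt0// ltrD2r gtr0_norm//.
    case: ifPn => _; last by rewrite mule0.
    by rewrite -!EFinD -EFinM; congr EFin; field; rewrite gt_eqF.
  have a_lt0 : a < 0 by rewrite lt_neqAle a0.
  rewrite (_ : f @^-1` _ = `[(v - b) / a, (u - b) / a[%classic); last first.
    apply/seteqP; split => t /=; rewrite /f !in_itv/= ltr_ndivlMr// ler_ndivrMr//;
      by rewrite mulrC ltrBlDl lerBrDl andbC.
  rewrite lebesgue_measure_itv/= lte_fin ltr_nM2r ?invr_lt0// ltrD2r ltr0_norm//.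
  case: ifPn => _; last by rewrite mule0.
  by rewrite -!EFinD -EFinM; congr EFin; field.
Qed.

Lemma ge0_integral_affine_line (a b : R) (f : R -> \bar R) : a != 0 ->
  measurable_fun setT (f : measurableTypeR R -> \bar R) -> (forall t, 0 <= f t)%E ->
  (\int[mu]_t f (b + a * t)%R = `|a|^-1%:E * \int[mu]_t f t)%E.
Proof.
move=> a0 mf f0; pose h (t : measurableTypeR R) : measurableTypeR R := b + a * t.
have mh : measurable_fun setT h := measurable_affine_line a b.
have := @ge0_integral_pushforward _ _ _ _ R h mh mu setT f measurableT mf (fun y _ => f0 y).
rewrite preimage_setT => <-.
have na0 : 0 <= `|a|^-1 by rewrite invr_ge0.
rewrite -(ge0_integral_mscale mu measurableT (NngNum na0) mf)//.
by apply: eq_measure_integral => X mX _; exact: lebesgue_measure_affine.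
Qed.

End affine_lebesgue_line.

Section affine_lebesgue.
Context {R : realType}.
Local Notation mu := (@lebesgue_measure R).

Lemma measurable_affine_map d (x0 : 'cV[R]_d) (A : 'M[R]_d) :
  measurable_fun setT (affine_map x0 A).
Proof.
apply: measurable_fun_cVP => i.
under eq_fun do rewrite /affine_map !mxE.
apply: measurable_funD => //; apply: measurable_sum => j.
by apply: measurable_funM => //; exact: measurable_coor.
Qed.

(** All translations are included: below a pivot, the block triangular case needs
    the induction hypothesis with a translation that depends on the first
    coordinate. *)
Definition change_of_variables d (A : 'M[R]_d) := forall (x0 : 'cV[R]_d) (f : 'cV[R]_d -> \bar R),
  measurable_fun setT f -> (forall x, 0 <= f x)%E ->
  (\int[lebesgue_cV d]_x f (affine_map x0 A x) =
   `|\det A|^-1%:E * \int[lebesgue_cV d]_x f x)%E.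

Lemma measurable_comp_affine_map d x0 (A : 'M[R]_d) (f : 'cV[R]_d -> \bar R) :
  measurable_fun setT f -> measurable_fun setT (f \o affine_map x0 A).
Proof. by move=> mf; apply: measurableT_comp => //; exact: measurable_affine_map. Qed.

Lemma change_of_variablesM d (A B : 'M[R]_d) :
  change_of_variables A -> change_of_variables B -> change_of_variables (A *m B).
Proof.
move=> cA cB x0 f mf f0.
transitivity (\int[lebesgue_cV d]_x f (affine_map x0 A (affine_map 0 B x)))%E.
  by apply: eq_integral => x _; rewrite /affine_map add0r mulmxA.
rewrite (cB 0 _ (measurable_comp_affine_map x0 A mf) (fun x => f0 _)) cA//.
by rewrite muleA -EFinM det_mulmx normrM invfM mulrC.
Qed.

Lemma integral_lebesgue_cVS d (f : 'cV[R]_d.+1 -> \bar R) :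
  measurable_fun setT f -> (forall x, 0 <= f x)%E ->
  (\int[lebesgue_cV d.+1]_x f x =
   \int[mu]_t \int[lebesgue_cV d]_x f (cons_cV (t, x)))%E.
Proof.
move=> mf f0 /=; rewrite /lebesgue_step.
rewrite (ge0_integral_pushforward (@measurable_cons_cV R d))//.
have mfc : measurable_fun setT (f \o @cons_cV R d).
  by apply: measurableT_comp => //; exact: measurable_cons_cV.
by rewrite preimage_setT (fubini_tonelli1 _ mfc (fun _ => f0 _)).
Qed.

Lemma cons_cVE d (t : R) (x : 'cV[R]_d) :
  cons_cV (t, x) = col_mx t%:M x :> 'cV[R]_(1 + d).
Proof.
apply/colP => i; case: (split_ordP i) => j ->.
  rewrite ord1 col_mxEu [RHS]mxE eqxx mulr1n.
  by rewrite (_ : lshift d ord0 = ord0 :> 'I_(1 + d)) ?cons_cV0//; exact: val_inj.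
rewrite col_mxEd (_ : rshift 1 j = lift ord0 j :> 'I_(1 + d)) ?cons_cVS//.
exact: val_inj.
Qed.

Lemma affine_map_block d (x0 : 'cV[R]_(1 + d)) a (u : 'rV[R]_d) (l : 'cV[R]_d) (B : 'M[R]_d) t x :
  affine_map x0 (block_mx a%:M u l B) (cons_cV (t, x)) =
  cons_cV ((x0 ord0 ord0 + (u *m x) ord0 ord0) + a * t,
           affine_map (dsubmx x0 + t *: l) B x) :> 'cV[R]_(1 + d).
Proof.
rewrite /affine_map !cons_cVE mul_block_col -[in LHS](vsubmxK x0) add_col_mx.
rewrite -scalar_mxM mul_mx_scalar addrA; congr col_mx.
apply/matrixP => i j; rewrite !ord1 !mxE eqxx !mulr1n.
rewrite (_ : lshift d 0 = ord0 :> 'I_(1 + d)); last exact: val_inj.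
  by rewrite addrAC.
by rewrite addrA.
Qed.

Lemma measurable_cons_cV_pair d d0 (T : measurableType d0)
    (g : T -> measurableTypeR R) (h : T -> 'cV[R]_d) (f : 'cV[R]_d.+1 -> \bar R) :
  measurable_fun setT f -> measurable_fun setT g -> measurable_fun setT h ->
  measurable_fun setT (fun y => f (cons_cV (g y, h y))).
Proof.
move=> mf mg mh; apply: measurableT_comp => //.
apply: measurableT_comp; first exact: measurable_cons_cV.
exact: measurable_fun_pair.
Qed.

Lemma measurable_section_integral d (f : 'cV[R]_d.+1 -> \bar R) :
  measurable_fun setT f -> (forall x, 0 <= f x)%E ->
  measurable_fun setT
    (fun t : measurableTypeR R => \int[lebesgue_cV d]_x f (cons_cV (t, x)))%E.
Proof.
move=> mf f0.
apply: (measurable_fun_fubini_tonelli_F (fun z => f (cons_cV z))) => //.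
by apply: measurableT_comp => //; exact: measurable_cons_cV.
Qed.

Lemma det_block_lower d (a : R) (l : 'cV[R]_d) (B : 'M[R]_d) :
  `|\det (block_mx a%:M 0 l B)|^-1 = `|a|^-1 * `|\det B|^-1.
Proof. by rewrite det_lblock det_scalar expr1 normrM invfM. Qed.

(** For fixed first coordinate the remaining ones undergo an affine map with
    linear part [B]; integrating them out leaves a function of the first
    coordinate, to which the one-dimensional case applies. *)
Lemma change_of_variables_lower d (a : R) (l : 'cV[R]_d) (B : 'M[R]_d) :
  a != 0 -> change_of_variables B -> change_of_variables (block_mx a%:M 0 l B : 'M[R]_(1 + d)).
Proof.
move=> a0 cB x0 f mf f0.
have mfA := measurable_comp_affine_map x0 (block_mx a%:M 0 l B) mf.
rewrite det_block_lower EFinM !integral_lebesgue_cVS//.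
under eq_integral => t _ do under eq_integral => x _ do
  rewrite affine_map_block mul0mx mxE addr0.
have m1 t : measurable_fun setT (fun x : 'cV[R]_d => f (cons_cV (t, x))).
  by apply: measurable_cons_cV_pair.
under eq_integral => t _ do
  rewrite (cB _ (fun x => f (cons_cV (_, x))) (m1 _) (fun _ => f0 _)).
have mF := measurable_section_integral mf f0.
pose F (t : measurableTypeR R) := (\int[lebesgue_cV d]_x f (cons_cV (t, x)))%E.
have F0 t : (0 <= F t)%E by apply: integral_ge0.
rewrite ge0_integralZl_EFin//; last 2 first.
- by move=> t _; exact: (F0).
- by apply: (measurableT_comp mF); exact: measurable_affine_line.
by rewrite (ge0_integral_affine_line _ a0 mF F0) muleCA muleA.
Qed.

(** Here the first coordinate is integrated out before the others, because its
    translation depends on them; Tonelli's theorem is used to exchange the order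
    and to restore it. *)
Lemma change_of_variables_upper d (a : R) (u : 'rV[R]_d) (B : 'M[R]_d) :
  a != 0 -> change_of_variables B -> change_of_variables (block_mx a%:M u 0 B : 'M[R]_(1 + d)).
Proof.
move=> a0 cB x0 f mf f0.
have mfA := measurable_comp_affine_map x0 (block_mx a%:M u 0 B) mf.
rewrite det_ublock det_scalar expr1 normrM invfM EFinM !integral_lebesgue_cVS//.
under eq_integral => t _ do under eq_integral => x _ do
  rewrite affine_map_block scaler0 addr0.
pose b (x : 'cV[R]_d) : R := x0 ord0 ord0 + (u *m x) ord0 ord0.
pose y x := affine_map (dsubmx x0) B x.
have mb : measurable_fun setT (b : 'cV[R]_d -> measurableTypeR R).
  apply: measurable_funD => //; under eq_fun do rewrite mxE.
  by apply: measurable_sum => j; apply: measurable_funM => //; exact: measurable_coor.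
have my : measurable_fun setT y := measurable_affine_map _ _.
have mk : measurable_fun setT (fun z : measurableTypeR R * 'cV[R]_d =>
    f (cons_cV (b z.2 + a * z.1, y z.2))).
  apply: measurable_cons_cV_pair => //; last exact: measurableT_comp.
  apply: measurable_funD; first exact: (measurableT_comp mb).
  by apply: measurable_funM => //; exact: measurable_fst.
have mk' : measurable_fun setT (fun z : measurableTypeR R * 'cV[R]_d =>
    f (cons_cV (z.1, y z.2))).
  by apply: measurable_cons_cV_pair => //; exact: measurableT_comp.
have mt x : measurable_fun setT (fun t : measurableTypeR R => f (cons_cV (t, x))).
  by apply: measurable_cons_cV_pair.
have mx t : measurable_fun setT (fun x : 'cV[R]_d => f (cons_cV (t, x))).
  by apply: measurable_cons_cV_pair.
rewrite (fubini_tonelli _ mk (fun _ => f0 _)).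
under eq_integral => x _ do
  rewrite /= (ge0_integral_affine_line _ a0 (mt _) (fun _ => f0 _)).
rewrite ge0_integralZl_EFin//; last 2 first.
- by move=> x _; apply: integral_ge0.
- exact: (measurable_fun_fubini_tonelli_G _ mk' (fun _ => f0 _)).
rewrite -(fubini_tonelli _ mk' (fun _ => f0 _)) -muleA; congr (_ * _)%E.
under eq_integral => t _ do rewrite (cB _ _ (mx _) (fun _ => f0 _)).
rewrite ge0_integralZl_EFin//.
- by move=> t _; apply: integral_ge0.
- exact: measurable_section_integral.
Qed.

(** Adding a combination of the other columns to the first one makes the first
    diagonal entry nonzero, so that elimination needs no permutation. *)
Lemma exists_pivot d (A : 'M[R]_(1 + d)) : \det A != 0 ->
  exists w : 'cV[R]_d, (ulsubmx A + ursubmx A *m w) ord0 ord0 != 0.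
Proof.
move=> detA; have [a0|a0] := eqVneq (ulsubmx A ord0 ord0) 0; last first.
  by exists 0; rewrite mulmx0 addr0.
have [u0|/rV0Pn[j uj]] := eqVneq (ursubmx A) 0.
  case/eqP: detA; rewrite -(submxK A) u0 det_lblock (mx11_scalar (ulsubmx A)).
  by rewrite a0 det_scalar expr1 mul0r.
exists (delta_mx j ord0); rewrite -colE !mxE.
by move: a0 uj; rewrite !mxE => ->; rewrite add0r.
Qed.

(** After a shear on the right the first pivot [a] is nonzero, and the matrix is
    a lower block triangular matrix, with the Schur complement [B] of [a] in the
    corner, times an upper block unitriangular one. *)
Lemma integral_affine_map d (A : 'M[R]_d) : \det A != 0 -> change_of_variables A.
Proof.
elim: d A => [|d IH] A detA.
  move=> x0 f mf f0; rewrite det_mx00 normr1 invr1 mul1e.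
  by apply: eq_integral => x _; congr f; rewrite [LHS]flatmx0 [RHS]flatmx0.
move: A detA; rewrite -[d.+1]/(1 + d)%N => A detA.
have [w wA] := exists_pivot detA.
have cov1 : change_of_variables (1%:M : 'M[R]_d) by apply: IH; rewrite det1 oner_neq0.
pose A' := A *m block_mx 1%:M 0 w 1%:M.
have AE : A = A' *m block_mx 1%:M 0 (- w) 1%:M.
  rewrite /A' -mulmxA mulmx_block !(mulmx1, mul1mx, mulmx0, mul0mx, addr0, add0r).
  by rewrite addrN -scalar_mx_block mulmx1.
have detA' : \det A' != 0 by rewrite det_mulmx det_lblock !det1 !mulr1.
pose a := ulsubmx A' ord0 ord0; have a0 : a != 0.
  by rewrite /a /A' -[A in A *m _]submxK mulmx_block block_mxKul mulmx1.
have ulA : ulsubmx A' = a%:M := mx11_scalar _.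
pose B := drsubmx A' - a^-1 *: (dlsubmx A' *m ursubmx A').
have A'E : A' = block_mx a%:M 0 (dlsubmx A') B *m
                block_mx 1%:M (a^-1 *: ursubmx A') 0 1%:M.
  rewrite mulmx_block !(mulmx1, mul1mx, mulmx0, mul0mx, addr0, add0r).
  rewrite -!scalemxAr mul_scalar_mx scalerA mulVf// scale1r /B addrC subrK.
  by rewrite -ulA submxK.
have detB : \det B != 0.
  move: detA'; rewrite A'E det_mulmx det_lblock mulf_eq0 negb_or => /andP[+ _].
  by rewrite mulf_eq0 negb_or => /andP[].
rewrite AE A'E; apply: change_of_variablesM; first apply: change_of_variablesM.
- by apply: change_of_variables_lower => //; exact: IH.
- by apply: change_of_variables_upper => //; exact: oner_neq0.
- by apply: change_of_variables_lower => //; exact: oner_neq0.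
Qed.

End affine_lebesgue.

(** * Extrapolation along parabolas *)

Section parabola.
Context {R : realType} {d : nat}.
Implicit Types (p : mpoly d R) (c a b : 'cV[R]_d) (t : R).

(** The restriction of [p] to the parabola [t |-> c + t^2 a + t b]. *)
Definition parabola_poly p c a b : {poly R} :=
  mmap polyC (fun i => (c i ord0)%:P + b i ord0 *: 'X + a i ord0 *: 'X^2) p.

Lemma parabola_polyE p c a b t :
  (parabola_poly p c a b).[t] = mpoly_eval p (c + t ^+ 2 *: a + t *: b).
Proof.
rewrite /parabola_poly /mmap /mpoly_eval mevalE horner_sum; apply: eq_bigr => m _.
rewrite hornerM hornerC; congr (_ * _); rewrite horner_prod; apply: eq_bigr => i _.
by rewrite horner_exp !hornerE/= !mxE; congr (_ ^+ _); ring.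
Qed.

Lemma size_parabola_poly n p c a b : degree_le n p ->
  (size (parabola_poly p c a b) <= n.*2.+1)%N.
Proof.
move=> pn; rewrite /parabola_poly /mmap big_seq.
apply: leq_trans (size_sum _ _ _) _; apply/bigmax_leqP_seq => m mp _.
have mn : (mdeg m <= n)%N.
  by rewrite -ltnS (leq_trans _ pn)// msize_mdeg_lt.
rewrite mul_polyC; apply: leq_trans (size_scale_leq _ _) _.
rewrite /mmap1; apply: leq_trans (size_prod_leq _ _) _.
set q := BIG_F.
have q3 i : (q i <= (m i).*2.+1)%N.
  apply: leq_trans (size_exp_leq _ _) _; rewrite ltnS -muln2 mulnC leq_mul2l.
  apply/orP; right; rewrite -subn1 leq_subLR.
  rewrite (leq_trans (size_polyD _ _))// geq_max (leq_trans (size_polyD _ _)).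
    by rewrite (leq_trans (size_scale_leq _ _))// size_polyXn.
  rewrite geq_max (leq_trans (size_polyC_leq1 _))//.
  by rewrite (leq_trans (size_scale_leq _ _))// size_polyX.
rewrite leq_subLR (@leq_trans (\sum_(i < d) (m i).*2.+1).+1)//.
  by rewrite ltnS; apply: leq_sum => i _.
rewrite addnS ltnS.
under eq_bigr do rewrite -addn1 -muln2.
rewrite big_split/= -big_distrl/= sum_nat_const card_ord -mdegE muln1 muln2.
by rewrite addnC leq_add// ?leq_double// card_ord.
Qed.

Lemma even_poly_horner (P : {poly R}) t :
  (even_poly P).[t ^+ 2] = (P.[t] + P.[- t]) / 2.
Proof.
have E u : P.[u] = (even_poly P).[u ^+ 2] + (odd_poly P).[u ^+ 2] * u.
  by rewrite -{1}(poly_even_odd P) !hornerE !horner_comp !hornerE.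
by rewrite !E sqrrN; field.
Qed.

(** The even part in [t] of the restriction to a parabola is a polynomial of
    degree at most [n] in [t^2], whose value at [0] is [p(c)]: the odd part
    carries the square roots, and it cancels between [t] and [- t]. *)
Lemma parabola_extrapolation n N (s l : 'I_N -> R) p c a b :
  (forall k, 0 <= s k) ->
  (forall H : {poly R}, (size H <= n.+1)%N ->
    H.[0] = \sum_(k < N) l k * H.[s k]) ->
  degree_le n p ->
  mpoly_eval p c = \sum_(k < N) l k *
    ((mpoly_eval p (c + s k *: a + Num.sqrt (s k) *: b) +
      mpoly_eval p (c + s k *: a - Num.sqrt (s k) *: b)) / 2).
Proof.
move=> s0 sl pn; pose P := parabola_poly p c a b.
transitivity ((even_poly P).[0 ^+ 2]).
  by rewrite even_poly_horner oppr0 mulrDl -splitr parabola_polyE expr0n/= !scale0r !addr0.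
rewrite expr0n/= sl; last first.
  rewrite (leq_trans (size_even_poly _))//.
  have := size_parabola_poly c a b pn; rewrite -/P => /uphalf_leq.
  by rewrite /= doubleK.
apply: eq_bigr => k _; congr (_ * _).
rewrite -{1}(sqr_sqrtr (s0 k)) even_poly_horner !parabola_polyE sqrrN.
by rewrite sqr_sqrtr// scaleNr.
Qed.

End parabola.

(** * Averaging an extrapolation formula *)

Section averaging.
Context {R : realType}.

(** Cauchy-Schwarz with weights [|l i|], obtained by summing
    [2 t l_i x_i <= |l_i| (x_i^2 + t^2)]. *)
Lemma sqr_sum_le (I : finType) (l x : I -> R) (L : R) : 0 < L ->
  \sum_i `|l i| <= L ->
  (\sum_i l i * x i) ^+ 2 <= L * \sum_i `|l i| * x i ^+ 2.
Proof.
move=> L0 lL; set X := \sum_i _; set S := \sum_i _.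
(* The value of t for which 2 t X - t^2 L is largest. *)
pose t := X / L.
have : 2 * t * X <= S + t ^+ 2 * L.
  apply: (@le_trans _ _ (S + t ^+ 2 * \sum_i `|l i|)); last first.
    by rewrite lerD2l ler_wpM2l// sqr_ge0.
  rewrite /X /S !mulr_sumr -big_split/=; apply: ler_sum => i _.
  have l1 : l i * (2 * t * x i) <= `|l i| * `|2 * t * x i|.
    by rewrite -normrM ler_norm.
  rewrite mulrCA; apply: le_trans l1 _.
  rewrite [t ^+ 2 * _]mulrC -mulrDr ler_wpM2l//.
  have := sqr_ge0 (x i - t); have := sqr_ge0 (x i + t) => h1 h2.
  by rewrite ler_norml; apply/andP; split; lra.
have -> : X = t * L by rewrite /t divfK// gt_eqF.
rewrite (_ : 2 * t * (t * L) = t ^+ 2 * L + t ^+ 2 * L); last by ring.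
rewrite lerD2r => h; rewrite exprMn [L ^+ 2]expr2 mulrA mulrC.
by rewrite ler_wpM2l// ltW.
Qed.

Lemma ge0_integral_affine_le d (D Q : set 'cV[R]_d) c (M : 'M[R]_d)
    (f : 'cV[R]_d -> \bar R) :
  measurable D -> measurable Q -> measurable_fun setT f ->
  (forall x, 0 <= f x)%E -> \det M != 0 ->
  (forall y, Q y -> D (affine_map c M y)) ->
  (\int[lebesgue_cV d]_(y in Q) f (affine_map c M y) <=
   `|\det M|^-1%:E * \int[lebesgue_cV d]_(x in D) f x)%E.
Proof.
move=> mD mQ mf f0 M0 QD.
have mfD : measurable_fun setT (f \_ D).
  by apply/(measurable_restrictT _ mD); exact: measurable_funTS.
have fD0 x : (0 <= (f \_ D) x)%E by rewrite patchE; case: ifP.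
have mfM := measurable_comp_affine_map c M mf.
rewrite [X in (_ * X)%E]integral_mkcond -(integral_affine_map M0 c mfD fD0).
rewrite integral_mkcond; apply: ge0_le_integral => //.
- by move=> y _; rewrite patchE; case: ifP.
- by apply/(measurable_restrictT _ mQ); exact: measurable_funTS.
- exact: (measurable_comp_affine_map c M mfD).
- move=> y _; rewrite patchE; case: ifPn => // /set_mem Qy.
  by rewrite patchE mem_set//; exact: QD.
Qed.

(** A formula reproducing [p(c)] from the values of [p] at finitely many points
    gives a bound by an [L^2] norm as soon as the points can be moved, each
    through an invertible affine map of a common parameter [y]. *)
Lemma averaged_extrapolation d (I : finType) (l : I -> R) (M : I -> 'M[R]_d)
    (p : mpoly d R) (c : 'cV[R]_d) (D Q : set 'cV[R]_d) (L rho q : R) :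
  measurable D -> measurable Q -> lebesgue_cV d Q = q%:E -> 0 < q ->
  0 < L -> \sum_i `|l i| <= L ->
  0 < rho -> (forall i, rho <= `|\det (M i)|) ->
  (forall i y, Q y -> D (affine_map c (M i) y)) ->
  (forall y, Q y -> mpoly_eval p c = \sum_i l i * mpoly_eval p (affine_map c (M i) y)) ->
  ((mpoly_eval p c ^+ 2)%:E <=
   (L ^+ 2 / (rho * q))%:E * \int[lebesgue_cV d]_(x in D) (mpoly_eval p x ^+ 2)%:E)%E.
Proof.
move=> mD mQ Qq q0 L0 lL rho0 rhoM MD pE.
pose f (x : 'cV[R]_d) := (mpoly_eval p x ^+ 2)%:E.
have mf : measurable_fun setT f.
  by apply/measurable_EFinP; apply: measurable_funX; exact: measurable_mpoly_eval.
have f0 x : (0 <= f x)%E by rewrite lee_fin sqr_ge0.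
set J := (\int[_]_(x in D) _)%E.
have J0 : (0 <= J)%E by apply: integral_ge0 => x _; exact: f0.
have step i : (\int[lebesgue_cV d]_(y in Q) f (affine_map c (M i) y) <= rho^-1%:E * J)%E.
  have Mi : 0 < `|\det (M i)| := lt_le_trans rho0 (rhoM i).
  apply: le_trans (ge0_integral_affine_le mD mQ mf f0 _ (MD i)) _.
    by rewrite -normr_gt0.
  by rewrite lee_wpmul2r// lee_fin lef_pV2.
have mfM i : measurable_fun Q (fun y => f (affine_map c (M i) y)).
  exact: measurable_funTS (measurable_comp_affine_map c (M i) mf).
have : (\int[lebesgue_cV d]_(y in Q) f c <=
        \int[lebesgue_cV d]_(y in Q) \sum_i (L * `|l i|)%:E * f (affine_map c (M i) y))%E.
  apply: ge0_le_integral => //.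
  - by apply: emeasurable_sum => i; apply: emeasurable_funM.
  - move=> y Qy; rewrite {1}/f (pE y Qy).
    under [X in (_ <= X)%E]eq_bigr => i _ do rewrite /f -EFinM.
    rewrite sumEFin lee_fin (le_trans (sqr_sum_le _ L0 lL))// mulr_sumr.
    by apply: ler_sum => i _; rewrite mulrA.
rewrite integral_cst//= Qq ge0_integral_sum//; last 2 first.
- by move=> i; apply: emeasurable_funM.
- by move=> i y _; rewrite mule_ge0// lee_fin mulr_ge0// ltW.
move=> h.
have {h} : (f c * q%:E <= (L ^+ 2)%:E * (rho^-1%:E * J))%E.
  apply: le_trans h _.
  apply: (@le_trans _ _ (\sum_i (L * `|l i|)%:E * (rho^-1%:E * J))%E).
    apply: lee_sum => i _; rewrite ge0_integralZl_EFin//; last first.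
      by rewrite mulr_ge0// ltW.
    by rewrite lee_wpmul2l// lee_fin mulr_ge0// ltW.
  have rJ0 : (0 <= rho^-1%:E * J)%E by rewrite mule_ge0// lee_fin invr_ge0 ltW.
  rewrite -ge0_sume_distrl; last by move=> i _; rewrite lee_fin mulr_ge0// ltW.
  rewrite lee_wpmul2r// sumEFin lee_fin -mulr_sumr expr2.
  by rewrite ler_wpM2l// ltW.
rewrite -(lee_pdivlMr _ _ q0) => h; apply: le_trans h _.
by rewrite muleA -EFinM muleAC -EFinM invfM mulrA.
Qed.

End averaging.

(** * The extremal property of the Christoffel function *)

Section christoffel_bound.
Context {R : realType} {d : nat}.

(** The polynomial [p = sum_k phi_k(x) phi_k] satisfies
    [p(x) = int_D p^2 = sum_k phi_k(x)^2], so the hypothesis at this [p] reads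
    [s^2 <= K s] for the sum [s] in question. *)
Lemma christoffel_le n (D : set 'cV[R]_d) (x : 'cV[R]_d) (K : R) :
  compact D -> 0 <= K ->
  (forall p, degree_le n p ->
    ((mpoly_eval p x ^+ 2)%:E <=
     K%:E * \int[lebesgue_cV d]_(y in D) (mpoly_eval p y ^+ 2)%:E)%E) ->
  christoffel n D x <= K.
Proof.
move=> cD K0 pK; rewrite /christoffel.
set S := [set s | _].
(* Without an orthonormal basis the choice operator returns its default value 0. *)
have [[s Ss]|S0] := pselect (exists s, S s); last first.
  have -> : get S = 0 by apply: getPN => s Ss; apply: S0; exists s.
  by [].
have := @getPex _ S (ex_intro _ s Ss).
move: (get S) => _ [N [phi [bphi ophi ->]]]; have [dphi _ _] := bphi.
set s' := \sum_k _; have s0 : 0 <= s' by apply: sumr_ge0 => k _; exact: sqr_ge0.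
pose p := \sum_(k < N) mpoly_eval (phi k) x *: phi k.
have pE y : mpoly_eval p y = \sum_k mpoly_eval (phi k) x * mpoly_eval (phi k) y.
  rewrite /mpoly_eval raddf_sum/=; apply: eq_bigr => k _; exact: mevalZ.
have pn : degree_le n p.
  rewrite /degree_le /p (leq_trans (msize_sum _ _ _))//; apply/bigmax_leqP => k _.
  by rewrite (leq_trans (msizeZ_le _ _))//; exact: dphi.
have mD := compact_measurable_cV cD.
have px : mpoly_eval p x = s' by rewrite pE; apply: eq_bigr => k _; rewrite expr2.
have ip : (\int[lebesgue_cV d]_(y in D) (mpoly_eval p y ^+ 2)%:E = s'%:E)%E.
  under eq_integral => y _.
    rewrite pE expr2 mulr_suml -sumEFin.
    under eq_bigr => i _.
      rewrite mulr_sumr -sumEFin.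
      under eq_bigr => j _ do rewrite mulrACA EFinM.
      over.
    over.
  rewrite integral_sum//=; last first.
    move=> i; apply: integrable_sum => // j _; apply: integrableZl => //.
    exact: integrable_orthonormal.
  rewrite -sumEFin; apply: eq_bigr => i _.
  rewrite integral_sum//=; last first.
    move=> j; apply: integrableZl => //; exact: integrable_orthonormal.
  rewrite (bigD1 i)//= integralZl//; last exact: integrable_orthonormal.
  rewrite ophi eqxx mule1 big1 ?adde0 ?expr2// => j ji.
  rewrite integralZl//; last exact: integrable_orthonormal.
  by rewrite ophi eq_sym (negbTE ji) mule0.
have := pK p pn; rewrite px ip -EFinM lee_fin expr2.
by have [->//|s1] := eqVneq s' 0; rewrite ler_pM2r// lt_neqAle eq_sym s1.
Qed.

End christoffel_bound.

(** * The parabolas stay in the unit ball *)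

Section geometry.
Context {R : realType} (d : nat).

(** The linear map taking [y] to the points with parameter [t = e * sqrt s],
    [e = 1] or [e = -1], on the parabola [t |-> (- t^2 y_0, t y')]. *)
Definition parabolic_mx (s e : R) : 'M[R]_d.+1 :=
  diag_mx (\row_i (if i == ord0 then - s else e * Num.sqrt s)).

Lemma parabolic_mxE (s e : R) (y : 'cV[R]_d.+1) i :
  (parabolic_mx s e *m y) i ord0 =
  (if i == ord0 then - s else e * Num.sqrt s) * y i ord0.
Proof. by rewrite mul_diag_mx !mxE. Qed.

Lemma det_parabolic_mx (s e : R) : 0 <= s -> `|e| = 1 ->
  `|\det (parabolic_mx s e)| = s * Num.sqrt s ^+ d.
Proof.
move=> s0 e1; rewrite det_diag big_ord_recl normrM mxE eqxx normrN (ger0_norm s0).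
congr (_ * _); rewrite (eq_bigr (fun=> e * Num.sqrt s)).
  by rewrite prodr_const card_ord normrX normrM e1 mul1r ger0_norm// sqrtr_ge0.
by move=> i _; rewrite mxE.
Qed.

(** The first coordinate ranges over an interval bounded away from [0], so that
    the parabola has entered the ball at the smallest node; the others are so
    small that their squares add up to at most [1/8]. *)
Definition thin_box : set 'cV[R]_d.+1 := [set y | forall i,
  (if i == ord0 then `[1, 2]%classic
   else `[- (3 * d.+1%:R)^-1, (3 * d.+1%:R)^-1]%classic : set R) (y i ord0)].

Lemma measurable_thin_box : measurable thin_box.
Proof.
rewrite (_ : thin_box = \bigcap_(i in [set: 'I_d.+1])
  ((fun y : 'cV[R]_d.+1 => y i ord0 : measurableTypeR R) @^-1`
  (if i == ord0 then `[1, 2]%classic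
   else `[- (3 * d.+1%:R)^-1, (3 * d.+1%:R)^-1]%classic : set R))).
  apply: fin_bigcap_measurable => //= i _.
  rewrite -[X in measurable X]setTI; apply: (measurable_coor i) => //.
  by case: ifP => _; exact: measurable_itv.
by apply/seteqP; split => y /= Qy i; [move=> _; exact: Qy|exact: Qy i I].
Qed.

Definition thin_box_volume : R := (2 / (3 * d.+1%:R)) ^+ d.

Lemma thin_box_volume_gt0 : 0 < thin_box_volume.
Proof. by rewrite exprn_gt0// divr_gt0// mulr_gt0// ltr0n. Qed.

Lemma lebesgue_thin_box : lebesgue_cV d.+1 thin_box = thin_box_volume%:E.
Proof.
pose A (i : 'I_d.+1) : set (measurableTypeR R) := (if i == ord0 then `[1, 2]%classic
   else `[- (3 * d.+1%:R)^-1, (3 * d.+1%:R)^-1]%classic : set R).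
rewrite (@lebesgue_cV_box R d.+1 A); last first.
  by move=> i; rewrite /A; case: ifP => _; exact: measurable_itv.
have e0 : 0 < (3 * d.+1%:R)^-1 :> R by rewrite invr_gt0 mulr_gt0// ltr0n.
rewrite big_ord_recl {1}/A eqxx lebesgue_measure_itv/= lte_fin ltr1n/=.
rewrite (eq_bigr (fun=> (2 / (3 * d.+1%:R))%:E)) => [|i _]; last first.
  rewrite /A/= lebesgue_measure_itv/= lte_fin ifT; last by rewrite gtrN.
  by rewrite -EFinD opprK; congr EFin; rewrite [RHS]mulr_natl mulr2n.
have -> : ((2 : R)%:E - (1 : R)%:E = 1)%E by rewrite -EFinD; congr EFin; lra.
rewrite mul1e.
rewrite -(@big_morph _ _ EFin 1%E *%E 1 *%R)//.
by rewrite prodr_const card_ord.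
Qed.

(** With [dl = 1 / (3 n^2)] and [u = s y_0 - dl], the first coordinate is [1 - u]
    and the others contribute at most [s / 8].  Since [dl <= 3 s / 4], [u] lies
    between [s / 4] and [3 / 2], hence [u (2 - u) >= s / 8]. *)
Lemma parabolic_sub_ball (n : nat) (s e : R) (y : 'cV[R]_d.+1) :
  (0 < n)%N -> 4 / (9 * n%:R ^+ 2) <= s <= 3 / 4 -> `|e| = 1 -> thin_box y ->
  euclidean_ball (outer_point d.+1 n + parabolic_mx s e *m y).
Proof.
move=> n0 /andP[s1 s2] e1 Qy.
have n1 : 0 < n%:R :> R by rewrite ltr0n.
have s0 : 0 <= s by apply: le_trans s1; rewrite divr_ge0// mulr_ge0// sqr_ge0.
have sqs : e ^+ 2 * Num.sqrt s ^+ 2 = s.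
  by rewrite sqr_sqrtr// -[e ^+ 2]real_normK ?num_real// e1 expr1n mul1r.
rewrite /euclidean_ball/= /euclidean_norm -sqrtr1 ler_sqrt// big_ord_recl.
rewrite [X in X ^+ 2]mxE parabolic_mxE !mxE/=.
have := Qy ord0; rewrite /= in_itv/= => /andP[y1 y2].
set D : R := d.+1%:R; have D1 : 1 <= D by rewrite ler1n.
have tail : \sum_(i < d) (outer_point d.+1 n + parabolic_mx s e *m y) (lift ord0 i) ord0 ^+ 2
    <= s / 8.
  apply: (@le_trans _ _ (\sum_(i < d) s * (3 * D)^-1 ^+ 2)).
    apply: ler_sum => i _; rewrite mxE parabolic_mxE !mxE/= add0r !exprMn sqs.
    rewrite ler_wpM2l//; have := Qy (lift ord0 i); rewrite /= in_itv/= => yi.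
    by rewrite -(real_normK (num_real (y _ _))) lerXn2r ?nnegrE ?invr_ge0 ?ler_norml// mulr_ge0//; lra.
  rewrite sumr_const card_ord -[X in X <= _]mulr_natr -mulrA ler_wpM2l//.
  have dD : d%:R = D - 1 by rewrite /D -natr1 addrK.
  rewrite dD exprVn mulrC ler_pdivrMr; last by rewrite exprn_gt0//; lra.
  by nra.
apply: le_trans (lerD (lexx _) tail) _.
set dl := (3 * n%:R ^+ 2)^-1.
have dls : dl <= 3 / 4 * s.
  apply: le_trans (ler_wpM2l _ s1); last by lra.
  by rewrite le_eqVlt; apply/orP; left; apply/eqP; rewrite /dl; field; rewrite gt_eqF.
have dl0 : 0 <= dl by rewrite invr_ge0 mulr_ge0// sqr_ge0.
pose u := s * y ord0 ord0 - dl.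
have sy1 : s <= s * y ord0 ord0 by rewrite ler_peMr.
have sy2 : s * y ord0 ord0 <= 3 / 4 * 2 by rewrite ler_pM//; lra.
have u1 : s / 4 <= u by rewrite /u; lra.
have u2 : u <= 3 / 2 by rewrite /u; lra.
rewrite (_ : 1 + dl + _ = 1 - u); last by rewrite /u; ring.
have : s / 4 * (1 / 2) <= u * (2 - u) by rewrite ler_pM//; lra.
by rewrite sqrrB; lra.
Qed.

End geometry.

(** * The bound at the outer point *)

Section outer_point_bound.
Context {R : realType} (d : nat).

(** The two signs of the square root are indexed by a boolean, so that the
    formula is a single sum of values of [p] at affine images of [y]. *)
Lemma parabolic_extrapolation n N (s l : 'I_N -> R) (p : mpoly d.+1 R)
    (c y : 'cV[R]_d.+1) (A : 'M[R]_d.+1) :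
  (forall k, 0 <= s k) ->
  (forall H : {poly R}, (size H <= n.+1)%N ->
    H.[0] = \sum_(k < N) l k * H.[s k]) ->
  degree_le n p ->
  mpoly_eval p c = \sum_(i : 'I_N * bool)
    l i.1 / 2 * mpoly_eval p (affine_map c (A *m parabolic_mx d (s i.1) ((-1) ^+ i.2)) y).
Proof.
move=> s0 sl pn.
pose a := A *m \col_i (if i == ord0 then - y i ord0 else 0).
pose b := A *m \col_i (if i == ord0 then 0 else y i ord0).
have E k (e : R) : affine_map c (A *m parabolic_mx d (s k) e) y =
    c + s k *: a + (e * Num.sqrt (s k)) *: b.
  rewrite /affine_map -mulmxA -addrA; congr (_ + _).
  rewrite /a /b 2!scalemxAr -mulmxDr; congr (_ *m _); apply/colP => i.
  by rewrite parabolic_mxE !mxE; case: ifP => _; ring.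
rewrite (parabola_extrapolation c a b s0 sl pn).
rewrite -(pair_bigA _ (fun k (e : bool) => l k / 2 *
  mpoly_eval p (affine_map c (A *m parabolic_mx d (s k) ((-1) ^+ e)) y)))/=.
apply: eq_bigr => k _; rewrite big_bool/= !E expr0 expr1 mul1r mulN1r scaleNr.
by field.
Qed.

Lemma christoffel_outer_point : exists2 c : R, 0 < c &
  forall n, (0 < n)%N -> forall (D : set 'cV[R]_d.+1) x0 (A : 'M[R]_d.+1),
    compact D -> \det A != 0 -> affine_map x0 A @` euclidean_ball `<=` D ->
    christoffel n D (affine_map x0 A (outer_point d.+1 n)) <=
      c * `|\det A|^-1 * n%:R ^+ d.+2.
Proof.
have [L L0 nodes] := @extrapolation_nodes R.
set q := @thin_box_volume R d; have q0 : 0 < q := thin_box_volume_gt0 _.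
exists (L ^+ 2 / q * (3 / 2) ^+ d.+2).
  by rewrite mulr_gt0 ?divr_gt0 ?exprn_gt0 ?divr_gt0.
move=> n n0 D x0 A cD A0 AD.
have [s [l [s1 sl lL]]] := nodes n n0.
have n1 : 0 < n%:R :> R by rewrite ltr0n.
set v := outer_point d.+1 n.
(* The nodes are at least r^2, so the determinants are at least |det A| r^(d+2)
   in dimension d + 1. *)
pose r : R := 2 / (3 * n%:R); have r0 : 0 < r by rewrite divr_gt0// mulr_gt0.
have rs k : r ^+ 2 <= s k.
  have /andP[+ _] := s1 k; apply: le_trans; rewrite le_eqVlt; apply/orP; left.
  by apply/eqP; rewrite /r; field; rewrite gt_eqF.
have s0 k : 0 <= s k := le_trans (sqr_ge0 r) (rs k).
have rsq k : r <= Num.sqrt (s k).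
  by rewrite -(ger0_norm (ltW r0)) -sqrtr_sqr ler_sqrt.
have A1 : 0 < `|\det A| by rewrite normr_gt0.
pose rho := `|\det A| * r ^+ d.+2.
have rho0 : 0 < rho by rewrite mulr_gt0// exprn_gt0.
have -> : L ^+ 2 / q * (3 / 2) ^+ d.+2 * `|\det A|^-1 * n%:R ^+ d.+2 =
    L ^+ 2 / (rho * q).
  have -> : L ^+ 2 / q * (3 / 2) ^+ d.+2 * `|\det A|^-1 * n%:R ^+ d.+2 =
      L ^+ 2 / q * `|\det A|^-1 * (3 / 2 * n%:R) ^+ d.+2 by rewrite (exprMn d.+2 (3 / 2) n%:R); ring.
  have -> : 3 / 2 * n%:R = r^-1 by rewrite /r; field; rewrite gt_eqF.
  by rewrite /rho exprVn !invfM; ring.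
apply: christoffel_le => //.
  by rewrite divr_ge0 ?sqr_ge0// ltW// mulr_gt0.
move=> p pn; set c := affine_map x0 A v.
pose M (i : 'I_n.+1 * bool) := A *m parabolic_mx d (s i.1) ((-1) ^+ i.2).
apply: (@averaged_extrapolation _ _ _ (fun i : 'I_n.+1 * bool => l i.1 / 2) M p c D
    (@thin_box R d) L rho q) => //.
- exact: compact_measurable_cV.
- exact: measurable_thin_box.
- exact: lebesgue_thin_box.
- rewrite -(pair_bigA _ (fun k (e : bool) => `|l k / 2|))/=.
  rewrite (eq_bigr (fun k => `|l k|))// => k _.
  by rewrite big_bool/= normrM (@ger0_norm _ 2^-1)// -splitr.
- move=> i; rewrite /M det_mulmx normrM ler_wpM2l//.
  rewrite det_parabolic_mx ?normr_sign//.
  have -> : r ^+ d.+2 = r ^+ 2 * r ^+ d by rewrite -exprD.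
  by rewrite ler_pM ?exprn_ge0 ?lerXn2r ?nnegrE ?sqrtr_ge0// ltW.
- move=> i y Qy; apply: AD.
  exists (v + parabolic_mx d (s i.1) ((-1) ^+ i.2) *m y).
    by apply: (parabolic_sub_ball n0 (s1 _) _ Qy); rewrite normr_sign.
  by rewrite /c /M /affine_map mulmxDr mulmxA addrA.
- move=> y _; exact: (parabolic_extrapolation c y A s0 sl pn).
Qed.

End outer_point_bound.

Theorem theorem5p2 (R : realType) (d : nat) (hd : (1 <= d)%N) :
  exists2 c : R, 0 < c &
    forall n : nat, (1 <= n)%N ->
    forall (D : set 'cV[R]_d) (x0 : 'cV[R]_d) (A : 'M[R]_d),
      compact D -> \det A != 0 ->
      affine_map x0 A @` euclidean_ball `<=` D ->
      christoffel n D (affine_map x0 A (outer_point d n)) <=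
        c * `|\det A|^-1 * n%:R ^+ d.+1.
Proof. by case: d hd => // d _; exact: christoffel_outer_point. Qed.
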